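(* Let $(\mathcal{A},\gamma,\mathbb{T})$ be a full $C^*$-dynamical system with $\mathcal{A}$ unital. For any finite subset $\{y_i\}$ (resp. $\{x_j\}$) of $\mathcal{A}^1$ satisfying $\sum_iy_i^*y_i=I$ (resp. $\sum_jx_jx_j^*=I$), the operator $T'$ (resp. $S'$) on $(\mathcal{A}^0)^*$, the Banach space adjoint of $T(a)=\sum_iy_iay_i^*$ (resp. $S(a)=\sum_jx_j^*ax_j$), $a\in\mathcal{A}^0$, leaves the space $\mathcal{T}(\mathcal{A}^0)$ stable. Let $t'$ (resp. $s'$) be the restriction of $T'$ (resp. $S'$) to $\mathcal{T}(\mathcal{A}^0)$. Then $t'$ (resp. $s'$) does not depend on the finite set $\{y_i\}\subset\mathcal{A}^1$ (resp. $\{x_j\}\subset\mathcal{A}^1$) satisfying $\sum_iy_i^*y_i=I$ (resp. $\sum_jx_jx_j^*=I$). Furthermore $t'$ and $s'$ are inverses of one another.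
   Context: $\gamma$ is a (strongly continuous) action of $\mathbb{T}$ on $\mathcal{A}$ by $*$-automorphisms, and $\mathcal{A}^k=\{a\in\mathcal{A}:\gamma_z(a)=z^ka\ \forall z\in\mathbb{T}\}$ for $k\in\mathbb{Z}$. The system is full if for every $k\in\mathbb{Z}$ the closed linear span of $\{xy:x\in\mathcal{A}^k,y\in\mathcal{A}^{-k}\}$ equals $\mathcal{A}^0$; fullness guarantees that finite sets $\{y_i\}$, $\{x_j\}$ as in the claim exist. $\mathcal{T}(\mathcal{A}^0)\subset(\mathcal{A}^0)^*$ is the Banach subspace of bounded trace functionals ($\tau(ab)=\tau(ba)$) on $\mathcal{A}^0$. *)

(* Defs.v *)
From HB Require Import structures.
From mathcomp Require Import all_boot all_order all_algebra.
From mathcomp Require Import finmap.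
From mathcomp Require Import complex.
From mathcomp Require Import all_classical all_reals all_analysis.

Set Implicit Arguments.
Unset Strict Implicit.
Unset Printing Implicit Defensive.

Import Order.TTheory GRing.Theory Num.Theory.
Import numFieldNormedType.Exports.

Local Open Scope classical_set_scope.
Local Open Scope ring_scope.

Declare Scope cstar_scope.

(* The product is part of the mixin because Hierarchy Builder rejects a join of
   algType and completeNormedModType: it would require numDomainType to inherit
   from an intermediate ring-with-norm structure. *)
HB.mixin Record CompleteNormedModule_isCStarAlgebra (R : realType) A
    & CompleteNormedModule R[i] A := {
  cmul : A -> A -> A;
  cone : A;
  star : A -> A;
  cmulA : associative cmul;
  cmul1l : left_id cone cmul;
  cmul1r : right_id cone cmul;
  cmulDl : left_distributive cmul +%R;
  cmulDr : right_distributive cmul +%R;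
  cmulZl : forall (c : R[i]) x y, cmul (c *: x) y = c *: cmul x y;
  cmulZr : forall (c : R[i]) x y, cmul x (c *: y) = c *: cmul x y;
  starD : {morph star : x y / x + y};
  starZ : forall (c : R[i]) x, star (c *: x) = c^* *: star x;
  starM : forall x y, star (cmul x y) = cmul (star y) (star x);
  starK : involutive star;
  ler_norm_cmul : forall x y, `|cmul x y| <= `|x| * `|y|;
  norm_star_cmul : forall x, `|cmul (star x) x| = `|x| ^+ 2
}.

#[short(type="cstarAlgType")]
HB.structure Definition CStarAlgebra (R : realType) :=
  {A of CompleteNormedModule_isCStarAlgebra R A & CompleteNormedModule R[i] A}.

Notation "x ** y" := (cmul x y) (at level 40, left associativity) : cstar_scope.
Notation "'\I'" := cone (at level 0) : cstar_scope.
Local Open Scope cstar_scope.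

Definition circle (R : realType) : Type :=
  set_type [set z : R[i]^o | `|z| = 1].

Section Circle.
Variable R : realType.
Implicit Types z w : circle R.

HB.instance Definition _ := SubChoice.on (circle R).
HB.instance Definition _ := Topological.on (circle R).

Definition circle_val z : R[i] := val z.

Lemma circle_normP z : `|circle_val z| = 1.
Proof. exact: set_mem (valP z). Qed.

Lemma circle_valK z : (circle_val z)^-1 * circle_val z = 1.
Proof. by rewrite mulVf// -normr_eq0 circle_normP oner_neq0. Qed.

Definition mk_circle (c : R[i]) (c1 : `|c| = 1) : circle R :=
  exist (fun c : R[i]^o => c \in _) c (mem_set c1).

Lemma circle1_subproof : `|1 : R[i]| = 1. Proof. exact: normr1. Qed.

Lemma circleV_subproof z : `|(circle_val z)^-1| = 1.
Proof. by rewrite normfV circle_normP invr1. Qed.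

Lemma circleM_subproof z w : `|circle_val z * circle_val w| = 1.
Proof. by rewrite normrM !circle_normP mulr1. Qed.

Definition circle1 := mk_circle circle1_subproof.
Definition circleV z := mk_circle (circleV_subproof z).
Definition circleM z w := mk_circle (circleM_subproof z w).

Lemma circleMA : associative circleM.
Proof. by move=> u v w; apply: val_inj; rewrite /= /circle_val/= mulrA. Qed.

Lemma circleM1l : left_id circle1 circleM.
Proof. by move=> z; apply: val_inj; rewrite /= /circle_val/= mul1r. Qed.

Lemma circleM1r : right_id circle1 circleM.
Proof. by move=> z; apply: val_inj; rewrite /= /circle_val/= mulr1. Qed.

Lemma circleMVl : left_inverse circle1 circleV circleM.
Proof. by move=> z; apply: val_inj; exact: circle_valK. Qed.

Lemma circleMVr : right_inverse circle1 circleV circleM.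
Proof.
by move=> z; apply: val_inj; rewrite -[RHS](circle_valK z)/= mulrC.
Qed.

HB.instance Definition _ := isGroup.Build (circle R)
  circleMA circleM1l circleM1r circleMVl circleMVr.

End Circle.

(* Each act z is bijective, hence an automorphism, by act1 and actM. *)
Record circle_action (R : realType) (A : cstarAlgType R) := CircleAction {
  act :> circle R -> {linear A -> A};
  act_cmul : forall z a b, act z (a ** b) = act z a ** act z b;
  act_star : forall z a, act z (star a) = star (act z a);
  act1 : forall a, act 1%g a = a;
  actM : forall z w a, act (z * w)%g a = act z (act w a);
  act_continuous : forall a, continuous (fun z => act z a)
}.

Section Spectral.
Variables (R : realType) (A : cstarAlgType R) (gamma : circle_action A).

Definition spectral_set (k : int) : set A :=
  [set a | forall z, gamma z a = (circle_val z) ^ k *: a].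

Definition spectral_pred (k : int) : {pred A} :=
  fun a => a \in spectral_set k.

Definition spectral (k : int) : Type := {a : A | spectral_pred k a}.

Definition in_spectral k a (ha : a \in spectral_pred k) : spectral k :=
  exist _ a ha.

HB.instance Definition _ k := SubChoice.on (spectral k).

Fact spectral_submod_closed k : submod_closed (spectral_pred k).
Proof.
split; first by apply/mem_set => z; rewrite linear0 scaler0.
move=> c x y /set_mem hx /set_mem hy; apply/mem_set => z.
by rewrite linearP hx hy scalerDr !scalerA mulrC.
Qed.

HB.instance Definition _ k := GRing.isSubmodClosed.Build R[i] A
  (spectral_pred k) (spectral_submod_closed k).
HB.instance Definition _ k :=
  [SubChoice_isSubLmodule of spectral k by <:].

Section Norm.
Variable k : int.
Let norm (a : spectral k) : R[i] := `|val a|.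

Let ler_normD (a b : spectral k) : norm (a + b) <= norm a + norm b.
Proof. exact: ler_normD. Qed.

Let normrZ (c : R[i]) (a : spectral k) : norm (c *: a) = `|c| * norm a.
Proof. exact: normrZ. Qed.

Let normr0_eq0 (a : spectral k) : norm a = 0 -> a = 0.
Proof. by move/normr0_eq0 => a0; exact: val_inj. Qed.

HB.instance Definition _ := Lmodule_isNormed.Build R[i] (spectral k)
  ler_normD normrZ normr0_eq0.
End Norm.

Lemma spectralP k (a : spectral k) z :
  gamma z (val a) = (circle_val z) ^ k *: val a.
Proof. exact: (set_mem (valP a)). Qed.

End Spectral.
Arguments spectral {R A} gamma k.

Section LinearSpan.
Variables (K : numFieldType) (V : lmodType K).

Definition linear_span (S : set V) : set V :=
  [set v | exists n (c : 'I_n -> K) (s : 'I_n -> V),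
    (forall i, S (s i)) /\ v = \sum_(i < n) c i *: s i].

End LinearSpan.

Definition full (R : realType) (A : cstarAlgType R) (gamma : circle_action A) :=
  forall k : int,
    closure (linear_span [set x ** y | x in spectral_set gamma k
                                     & y in spectral_set gamma (- k)])
      = spectral_set gamma 0.

Section BoundedLinear.
Variables (K : numFieldType).
Implicit Types V W : normedModType K.

(* For K = R[i], the inequality forces M to be real whenever V is nonzero. *)
Record bounded_linear V W := BoundedLinear {
  blin :> V -> W;
  blin_linear : linear blin;
  blin_bounded : exists M : K, forall x, `|blin x| <= M * `|x|
}.

HB.instance Definition _ V W (f : bounded_linear V W) :=
  GRing.isLinear.Build K V W *:%R (blin f) (blin_linear f).

Lemma bounded_linear_ext V W (f g : bounded_linear V W) : f =1 g -> f = g.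
Proof.
case: f g => [f f1 f2] [g g1 g2] /= /funext fg.
by rewrite -{}fg in g1 g2 *; congr BoundedLinear; exact: Prop_irrelevance.
Qed.

Definition dual V := bounded_linear V K^o.

Section Adjoint.
Variables (V W : normedModType K) (T : bounded_linear V W).

Fact adjoint_linear (phi : dual W) : linear (phi \o T : V -> K^o).
Proof. by move=> c x y; rewrite /= !linearP. Qed.

Fact adjoint_bounded (phi : dual W) :
  exists M : K, forall x, `|(phi \o T : V -> K^o) x| <= M * `|x|.
Proof.
have [M hM] := blin_bounded T; have [N hN] := blin_bounded phi.
exists (`|N| * M) => x /=; apply: (le_trans (hN _)).
have N0 : N * `|T x| <= `|N| * `|T x|.
  rewrite -[X in _ <= _ * X]normr_id -normrM real_ler_norm//.
  by rewrite ger0_real// (le_trans _ (hN (T x))).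
by rewrite (le_trans N0)// -mulrA ler_wpM2l.
Qed.

Definition adjoint (phi : dual W) : dual V :=
  BoundedLinear (adjoint_linear phi) (adjoint_bounded phi).

End Adjoint.
End BoundedLinear.

Section CStarTheory.
Variables (R : realType) (A : cstarAlgType R).
Implicit Types a b x y : A.

Lemma cmul_suml I (r : seq I) (F : I -> A) b :
  (\sum_(i <- r) F i) ** b = \sum_(i <- r) F i ** b.
Proof.
elim/big_rec2: _ => [|i y x _ <-]; last by rewrite cmulDl.
by rewrite -[X in X ** b](scale0r \I) cmulZl scale0r.
Qed.

Lemma cmul_sumr I (r : seq I) (F : I -> A) b :
  b ** (\sum_(i <- r) F i) = \sum_(i <- r) b ** F i.
Proof.
elim/big_rec2: _ => [|i y x _ <-]; last by rewrite cmulDr.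
by rewrite -[X in b ** X](scale0r \I) cmulZr scale0r.
Qed.

End CStarTheory.

Lemma conj_exprz (C : numClosedFieldType) (c : C) (k : int) :
  `|c| = 1 -> (c ^ k)^* = c ^ (- k).
Proof.
move=> c1; have -> : (c ^ k)^* = (c^*) ^ k.
  by case: k => n /=; rewrite -?exprnN ?exprnP ?fmorphV rmorphXn.
by rewrite -exprz_inv invC_norm c1 expr1n invr1 mul1r.
Qed.

Section Traces.
Variables (R : realType) (A : cstarAlgType R) (gamma : circle_action A).
Local Notation A0 := (spectral gamma 0).
Local Notation A1 := (spectral gamma 1).

Lemma spectral_star k a :
  a \in spectral_pred gamma k -> star a \in spectral_pred gamma (- k).
Proof.
move=> /set_mem ha; apply/mem_set => z; rewrite act_star ha starZ.
by congr (_ *: _); exact/conj_exprz/circle_normP.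
Qed.

Lemma spectral_cmul k l a b :
  a \in spectral_pred gamma k -> b \in spectral_pred gamma l ->
  a ** b \in spectral_pred gamma (k + l).
Proof.
move=> /set_mem ha /set_mem hb; apply/mem_set => z.
rewrite act_cmul ha hb cmulZl cmulZr scalerA.
by rewrite -expfzDr// -normr_eq0 circle_normP oner_neq0.
Qed.

Definition mul0 (a b : A0) : A0 :=
  in_spectral (spectral_cmul (valP a) (valP b)).

Definition trace (tau : dual A0) : Prop :=
  forall a b : A0, tau (mul0 a b) = tau (mul0 b a).

Definition traces : Type := {tau : dual A0 | trace tau}.

Definition stable (F : dual A0 -> dual A0) : Prop :=
  forall tau, trace tau -> trace (F tau).

Definition restriction (F : dual A0 -> dual A0) (hF : stable F)
    (tau : traces) : traces :=
  exist trace (F (sval tau)) (hF (sval tau) (svalP tau)).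

Variable Y : {fset A1}.

Fact opT_subproof (a : A0) :
  \sum_(y <- Y) val y ** val a ** star (val y) \in spectral_pred gamma 0.
Proof.
apply: rpred_sum => y _.
exact: (spectral_cmul (spectral_cmul (valP y) (valP a))
                      (spectral_star (valP y))).
Qed.

Fact opS_subproof (a : A0) :
  \sum_(x <- Y) star (val x) ** val a ** val x \in spectral_pred gamma 0.
Proof.
apply: rpred_sum => x _.
exact: (spectral_cmul (spectral_cmul (spectral_star (valP x)) (valP a))
                      (valP x)).
Qed.

Definition opT_fun (a : A0) : A0 := in_spectral (opT_subproof a).
Definition opS_fun (a : A0) : A0 := in_spectral (opS_subproof a).

Fact opT_linear : linear opT_fun.
Proof.
move=> c a b; apply: val_inj => /=.
rewrite scaler_sumr -big_split/=; apply: eq_bigr => y _.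
by rewrite cmulDr cmulZr cmulDl cmulZl.
Qed.

Fact opS_linear : linear opS_fun.
Proof.
move=> c a b; apply: val_inj => /=.
rewrite scaler_sumr -big_split/=; apply: eq_bigr => y _.
by rewrite cmulDr cmulZr cmulDl cmulZl.
Qed.

Fact opT_bounded : exists M : R[i], forall a, `|opT_fun a| <= M * `|a|.
Proof.
exists (\sum_(y <- Y) `|val y| * `|star (val y)|) => a.
rewrite mulr_suml (le_trans (ler_norm_sum _ _ _))//; apply: ler_sum => y _.
rewrite (le_trans (ler_norm_cmul _ _))// mulrAC ler_wpM2r//.
exact: ler_norm_cmul.
Qed.

Fact opS_bounded : exists M : R[i], forall a, `|opS_fun a| <= M * `|a|.
Proof.
exists (\sum_(x <- Y) `|star (val x)| * `|val x|) => a.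
rewrite mulr_suml (le_trans (ler_norm_sum _ _ _))//; apply: ler_sum => y _.
rewrite (le_trans (ler_norm_cmul _ _))// mulrAC ler_wpM2r//.
exact: ler_norm_cmul.
Qed.

Definition opT : bounded_linear A0 A0 := BoundedLinear opT_linear opT_bounded.
Definition opS : bounded_linear A0 A0 := BoundedLinear opS_linear opS_bounded.

End Traces.

(* Main.v *)
(** Since [sum_j y_j^* y_j = 1], inserting this sum between [a] and [b] gives
    [tau (T (a b)) = sum_(i,j) tau ((y_i a y_j^* ) (y_j b y_i^* ))], where both factors
    lie in the fixed-point algebra; the trace property swaps them, and the sum
    over [i] collapses to [tau (T2 (b a))], [T2] being defined by the [y_j].  The
    families [y_i] and [y_j] may differ: taking them equal shows that [T] preserves traces, and
    taking [b = 1] shows independence of the family.  The operator [S] is the same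
    construction for the degree -1 family [x_j^*].  Finally
    [tau (T (S a)) = sum_(i,j) tau ((y_i x_j^* a) (x_j y_i^* ))], and the swapped
    product telescopes to [tau a]. *)
Require Import Defs.
From mathcomp Require Import all_boot all_order all_algebra.
From mathcomp Require Import finmap.
From mathcomp Require Import complex.
From mathcomp Require Import all_classical all_reals all_analysis.

Import GRing.Theory.
Local Open Scope ring_scope.
Local Open Scope cstar_scope.

Section TraceSandwich.
Set Implicit Arguments.
Unset Strict Implicit.

Context {R : realType} {A : cstarAlgType R} {gamma : circle_action A}.
Local Notation A0 := (spectral gamma 0).
Local Notation pred := (spectral_pred gamma).

(** Each [gamma z] is onto, and the image of the unit is a unit for the range: multiply it by [\I],
    written as an image under [gamma z]. *)
Lemma act_cone z : gamma z \I = \I.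
Proof.
have gK : gamma z (gamma z^-1%g \I) = \I by rewrite -actM mulgV act1.
by rewrite -[LHS]cmul1r -{2}gK -act_cmul cmul1l gK.
Qed.

Lemma spectral_cone : \I \in pred 0.
Proof. by apply/mem_set => z; rewrite act_cone expr0z scale1r. Qed.

Lemma spectral_cmul_eq k l m a b : k + l = m ->
  a \in pred k -> b \in pred l -> a ** b \in pred m.
Proof. by move=> <-; exact: spectral_cmul. Qed.

(* Takes the junk value 0 outside the degree-0 part; it avoids carrying
   membership proofs inside algebraic expressions. *)
Definition dual_ext (tau : dual A0) (a : A) : R[i] := tau (insubd (0 : A0) a).

Variable tau : dual A0.

Lemma dual_ext_val a : dual_ext tau (val a) = tau a.
Proof. by rewrite /dual_ext valKd. Qed.

(** Degree 0 of every term keeps the junk value of [dual_ext] out, so linearity of [tau] applies. *)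
Lemma dual_ext_sum I (r : seq I) (F : I -> A) :
  (forall i, F i \in pred 0) ->
  dual_ext tau (\sum_(i <- r) F i) = \sum_(i <- r) dual_ext tau (F i).
Proof.
move=> F0; pose f i : A0 := in_spectral (F0 i).
have sumE : \sum_(i <- r) F i = val (\sum_(i <- r) f i) by rewrite raddf_sum.
rewrite sumE dual_ext_val linear_sum; apply: eq_bigr => i _.
exact: esym (dual_ext_val (f i)).
Qed.

Hypothesis tau_trace : trace tau.

Lemma dual_ext_trace a b : a \in pred 0 -> b \in pred 0 ->
  dual_ext tau (a ** b) = dual_ext tau (b ** a).
Proof.
move=> a0 b0; pose a' : A0 := in_spectral a0; pose b' : A0 := in_spectral b0.
by rewrite -[a ** b]/(val (mul0 a' b')) -[b ** a]/(val (mul0 b' a')) !dual_ext_val.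
Qed.

(** The degree is arbitrary so that [k = 1] serves T and [k = - 1] serves S; indexed families let
    the adjoints of the [x] be used without forming a new finite set. *)
Lemma trace_sandwich k I J (r : seq I) (s : seq J) (u : I -> A) (v : J -> A) a b :
  (forall i, u i \in pred k) -> (forall j, v j \in pred k) ->
  \sum_(i <- r) star (u i) ** u i = \I ->
  \sum_(j <- s) star (v j) ** v j = \I ->
  a \in pred 0 -> b \in pred 0 ->
  dual_ext tau (\sum_(i <- r) u i ** (a ** b) ** star (u i)) =
  dual_ext tau (\sum_(j <- s) v j ** (b ** a) ** star (v j)).
Proof.
move=> uk vk u1 v1 a0 b0.
have sandwich0 (x y c : A) : x \in pred k -> y \in pred k -> c \in pred 0 ->
    x ** c ** star y \in pred 0.
  move=> xk yk c0; apply: (spectral_cmul_eq (subrr k)); last exact: spectral_star.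
  exact: (spectral_cmul_eq (addr0 k)).
have ab0 : a ** b \in pred 0 by exact: spectral_cmul_eq (addr0 0) a0 b0.
have ba0 : b ** a \in pred 0 by exact: spectral_cmul_eq (addr0 0) b0 a0.
have prod0 (x y : A) : x \in pred 0 -> y \in pred 0 -> x ** y \in pred 0.
  exact: spectral_cmul_eq (addr0 0).
rewrite !dual_ext_sum; do ?[by move=> ?; exact: sandwich0].
transitivity (\sum_(i <- r) \sum_(j <- s)
    dual_ext tau ((u i ** a ** star (v j)) ** (v j ** b ** star (u i)))).
  apply: eq_bigr => i _; rewrite -dual_ext_sum; last first.
    by move=> j; apply: prod0; exact: sandwich0.
  (* The unit between [a] and [b] is expanded along [v]. *)
  congr (dual_ext tau _); rewrite -[in LHS](cmul1r a) -v1.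
  rewrite cmul_sumr cmul_suml cmul_sumr cmul_suml.
  by apply: eq_bigr => j _; rewrite !cmulA.
rewrite exchange_big; apply: eq_bigr => j _.
transitivity (\sum_(i <- r)
    dual_ext tau ((v j ** b ** star (u i)) ** (u i ** a ** star (v j)))).
  by apply: eq_bigr => i _; apply: dual_ext_trace; exact: sandwich0.
rewrite -dual_ext_sum; last by move=> i; apply: prod0; exact: sandwich0.
(* After the swap, the sum over [i] sits between [b] and [a] and is the unit. *)
congr (dual_ext tau _); rewrite -[in RHS](cmul1r b) -u1.
rewrite cmul_sumr cmul_suml cmul_sumr cmul_suml.
by apply: eq_bigr => i _; rewrite !cmulA.
Qed.

Lemma trace_sandwich_indep k I J (r : seq I) (s : seq J) (u : I -> A) (v : J -> A) a :
  (forall i, u i \in pred k) -> (forall j, v j \in pred k) ->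
  \sum_(i <- r) star (u i) ** u i = \I ->
  \sum_(j <- s) star (v j) ** v j = \I ->
  a \in pred 0 ->
  dual_ext tau (\sum_(i <- r) u i ** a ** star (u i)) =
  dual_ext tau (\sum_(j <- s) v j ** a ** star (v j)).
Proof.
move=> uk vk u1 v1 a0.
have := trace_sandwich uk vk u1 v1 a0 spectral_cone.
by rewrite cmul1r cmul1l.
Qed.

(** Opposite degrees put each [u i ** v j] in degree 0, so the trace property can move
    [star (v j) ** star (u i)] to the front. *)
Lemma trace_sandwichK k I J (r : seq I) (s : seq J) (u : I -> A) (v : J -> A) a :
  (forall i, u i \in pred k) -> (forall j, v j \in pred (- k)) ->
  \sum_(i <- r) star (u i) ** u i = \I ->
  \sum_(j <- s) star (v j) ** v j = \I ->
  a \in pred 0 ->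
  dual_ext tau (\sum_(i <- r) u i ** (\sum_(j <- s) v j ** a ** star (v j))
    ** star (u i)) = dual_ext tau a.
Proof.
move=> uk vk u1 v1 a0.
have left0 i j : u i ** v j ** a \in pred 0.
  by apply: (spectral_cmul_eq (addr0 0)) => //; exact: spectral_cmul_eq (subrr k) _ _.
have right0 i j : star (v j) ** star (u i) \in pred 0.
  apply: (spectral_cmul_eq (addNr (- k))); exact: spectral_star.
have prod0 (x y : A) : x \in pred 0 -> y \in pred 0 -> x ** y \in pred 0.
  exact: spectral_cmul_eq (addr0 0).
transitivity (dual_ext tau (\sum_(i <- r) \sum_(j <- s)
    (u i ** v j ** a) ** (star (v j) ** star (u i)))).
  congr (dual_ext tau _); apply: eq_bigr => i _.
  rewrite cmul_sumr cmul_suml; apply: eq_bigr => j _.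
  by rewrite !cmulA.
transitivity (dual_ext tau (\sum_(i <- r) \sum_(j <- s)
    (star (v j) ** star (u i)) ** (u i ** v j ** a))).
  rewrite !dual_ext_sum; do ?[by move=> i; apply: rpred_sum => j _; exact: prod0].
  apply: eq_bigr => i _.
  rewrite !dual_ext_sum; do ?[by move=> j; exact: prod0].
  by apply: eq_bigr => j _; exact: dual_ext_trace.
(* The sum over [i] must be innermost: it collapses between [star (v j)] and [v j], and only then
   does the sum over [j] give the unit. *)
congr (dual_ext tau _); rewrite exchange_big -[RHS]cmul1l -v1 cmul_suml.
apply: eq_bigr => j _; rewrite -[X in _ = X ** _ ** _]cmul1r -u1.
rewrite cmul_sumr !cmul_suml.
by apply: eq_bigr => i _; rewrite !cmulA.
Qed.

End TraceSandwich.

Section DualOperators.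
Set Implicit Arguments.
Unset Strict Implicit.

Context {R : realType} {A : cstarAlgType R} {gamma : circle_action A}.
Local Notation A0 := (spectral gamma 0).
Local Notation A1 := (spectral gamma 1).
Implicit Types (X Y : {fset A1}) (tau : dual A0) (a : A0).

Lemma spectral_star_val (x : A1) : star (val x) \in spectral_pred gamma (- 1).
Proof. exact: spectral_star (valP x). Qed.

(** Brings S to the shape of T, for the family of the [star (val x)]. *)
Lemma opS_val X a :
  val (opS X a) = \sum_(x <- X) star (val x) ** val a ** star (star (val x)).
Proof. by apply: eq_bigr => x _; rewrite starK. Qed.

Lemma sum_starK X : \sum_(x <- X) val x ** star (val x) = \I ->
  \sum_(x <- X) star (star (val x)) ** star (val x) = \I.
Proof. by move=> <-; apply: eq_bigr => x _; rewrite starK. Qed.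

Lemma adjoint_opT_stable Y : \sum_(y <- Y) star (val y) ** val y = \I ->
  stable (adjoint (opT Y)).
Proof.
move=> Y1 tau htau a b; rewrite /= -!dual_ext_val.
by apply: (trace_sandwich htau (k := 1)) => // *; exact: valP.
Qed.

Lemma adjoint_opS_stable X : \sum_(x <- X) val x ** star (val x) = \I ->
  stable (adjoint (opS X)).
Proof.
move=> /sum_starK X1 tau htau a b; rewrite /= -!dual_ext_val !opS_val.
apply: (trace_sandwich htau (k := - 1)) => //;
  by [exact: spectral_star_val | exact: valP].
Qed.

Lemma adjoint_opT_indep Y Y' tau : trace tau ->
  \sum_(y <- Y) star (val y) ** val y = \I ->
  \sum_(y <- Y') star (val y) ** val y = \I ->
  adjoint (opT Y) tau = adjoint (opT Y') tau.
Proof.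
move=> htau Y1 Y1'; apply: bounded_linear_ext => a; rewrite /= -!dual_ext_val.
by apply: (trace_sandwich_indep htau (k := 1)) => // *; exact: valP.
Qed.

Lemma adjoint_opS_indep X X' tau : trace tau ->
  \sum_(x <- X) val x ** star (val x) = \I ->
  \sum_(x <- X') val x ** star (val x) = \I ->
  adjoint (opS X) tau = adjoint (opS X') tau.
Proof.
move=> htau /sum_starK X1 /sum_starK X1'; apply: bounded_linear_ext => a.
rewrite /= -!dual_ext_val !opS_val.
apply: (trace_sandwich_indep htau (k := - 1)) => //;
  by [exact: spectral_star_val | exact: valP].
Qed.

(** Adjoints reverse composition: the left side is [tau] after T after S, so [Y] gives the outer
    family. *)
Lemma adjoint_opTK Y X tau : trace tau ->
  \sum_(y <- Y) star (val y) ** val y = \I ->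
  \sum_(x <- X) val x ** star (val x) = \I ->
  adjoint (opS X) (adjoint (opT Y) tau) = tau.
Proof.
move=> htau Y1 /sum_starK X1; apply: bounded_linear_ext => a.
rewrite /= -!dual_ext_val.
(* Only the outer operator is unfolded, so that [opS_val] can rewrite the inner one. *)
transitivity (dual_ext tau
  (\sum_(y <- Y) val y ** val (opS X a) ** star (val y))); first by [].
rewrite opS_val.
apply: (trace_sandwichK htau (k := 1)) => //;
  by [exact: spectral_star_val | move=> *; exact: valP].
Qed.

Lemma adjoint_opSK Y X tau : trace tau ->
  \sum_(y <- Y) star (val y) ** val y = \I ->
  \sum_(x <- X) val x ** star (val x) = \I ->
  adjoint (opT Y) (adjoint (opS X) tau) = tau.
Proof.
move=> htau Y1 /sum_starK X1; apply: bounded_linear_ext => a.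
rewrite /= -!dual_ext_val opS_val.
apply: (trace_sandwichK htau (k := - 1)) => //;
  by [exact: spectral_star_val | move=> *; rewrite ?opprK; exact: valP].
Qed.

Lemma traces_ext (sigma tau : traces gamma) : sval sigma = sval tau -> sigma = tau.
Proof. by case: sigma tau => [s hs] [t ht]; exact: eq_exist. Qed.

End DualOperators.

Theorem proposition2p1 (R : realType) (A : cstarAlgType R)
    (gamma : circle_action A) (gamma_full : full gamma) :
  exists (stableT : forall Y : {fset spectral gamma 1},
            \sum_(y <- Y) star (val y) ** val y = \I ->
            stable (adjoint (opT Y)))
         (stableS : forall X : {fset spectral gamma 1},
            \sum_(x <- X) val x ** star (val x) = \I ->
            stable (adjoint (opS X))),
    let t' Y hY := restriction (stableT Y hY) in
    let s' X hX := restriction (stableS X hX) in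
    [/\ forall Y1 Y2 hY1 hY2, t' Y1 hY1 = t' Y2 hY2,
        forall X1 X2 hX1 hX2, s' X1 hX1 = s' X2 hX2 &
        forall Y X hY hX,
          cancel (t' Y hY) (s' X hX) /\ cancel (s' X hX) (t' Y hY)].
Proof.
exists adjoint_opT_stable, adjoint_opS_stable => t' s'; split.
(* The two sides carry different stability proofs; [traces_ext] discards them. *)
- move=> Y1 Y2 hY1 hY2; apply/funext => -[tau htau].
  by apply: traces_ext; exact: adjoint_opT_indep.
- move=> X1 X2 hX1 hX2; apply/funext => -[tau htau].
  by apply: traces_ext; exact: adjoint_opS_indep.
- move=> Y X hY hX; split=> -[tau htau]; apply: traces_ext.
  + exact: adjoint_opTK.
  + exact: adjoint_opSK.
Qed.
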